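(* Every finite-dimensional anti-Zinbiel algebra over $\mathbb{C}$ is nilpotent.
   Context: An algebra means a complex vector space with a bilinear multiplication, not assumed associative. An anti-Zinbiel algebra is an algebra $Z$ satisfying $x(yz)=-(xy)z+x(zy)$ for all $x,y,z\in Z$ (i.e. a $(-1)$-Zinbiel algebra, where a $\delta$-Zinbiel algebra satisfies $x(yz)=\delta((xy)z-x(zy))$). Put $Z^1=Z$ and $Z^k=\sum_{i+j=k}Z^iZ^j$ for $k\ge 2$; $Z$ is nilpotent if $Z^k=0$ for some $k$. *)

(* Defs.v *)
From mathcomp Require Import all_boot all_order all_algebra.
From mathcomp Require Import reals complex.

Set Implicit Arguments.
Unset Strict Implicit.
Unset Printing Implicit Defensive.

Import GRing.Theory.
Local Open Scope ring_scope.

Section NonassociativeAlgebra.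
Variables (K : fieldType) (Z : vectType K) (mul : {bilinear Z -> Z -> Z}).
Implicit Types U V W : {vspace Z}.

Definition anti_zinbiel : Prop :=
  forall x y z : Z, mul x (mul y z) = - mul (mul x y) z + mul x (mul z y).

(* The span of all products u v with u in U and v in V: by bilinearity it is
   enough to multiply basis vectors (see mulvsP), as for prodv in falgebra. *)
Definition mulvs U V : {vspace Z} :=
  <<[seq mul u v | u <- vbasis U, v <- vbasis V]>>%VS.

(* The argument n only bounds the depth of the recursion; powvs takes n := k,
   and the recursive equations are powvs1 and powvsE.  The value fullv at
   k = 0 is a dummy. *)
Fixpoint powvs_rec (n k : nat) : {vspace Z} :=
  if n is n'.+1 then
    if (k <= 1)%N then fullv
    else (\sum_(1 <= i < k) mulvs (powvs_rec n' i) (powvs_rec n' (k - i)))%VS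
  else fullv.

Definition powvs (k : nat) : {vspace Z} := powvs_rec k k.

Definition nilpotent_alg : Prop := exists2 k, (0 < k)%N & powvs k = 0%VS.

Lemma mem_mulvs U V u v : u \in U -> v \in V -> mul u v \in mulvs U V.
Proof.
move=> /coord_vbasis -> /coord_vbasis ->.
rewrite linear_sumlz memv_suml // => i _; rewrite linear_sumr memv_suml // => j _.
rewrite linearZl_LR linearZr_LR !memvZ // memv_span //.
by apply/allpairsP; exists ((vbasis U)`_i, (vbasis V)`_j);
  rewrite /= !mem_nth ?size_tuple.
Qed.

Lemma mulvsP U V W :
  reflect (forall u v, u \in U -> v \in V -> mul u v \in W)
          (mulvs U V <= W)%VS.
Proof.
apply: (iffP idP) => [sUVW u v Uu Vv | sUVW].
  by rewrite (subvP sUVW) ?mem_mulvs.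
apply/span_subvP=> _ /allpairsP[[u v] /= [Uu Vv ->]].
by rewrite sUVW ?vbasis_mem.
Qed.

Lemma powvs1 : powvs 1 = fullv. Proof. by []. Qed.

Lemma powvs_recE n k : (k <= n)%N -> powvs_rec n k = powvs k.
Proof.
have gen m : forall p q, (m <= p)%N -> (m <= q)%N ->
    powvs_rec p m = powvs_rec q m.
  elim/ltn_ind: m => -[|m] IHm [|p] [|q] //= lemp lemq.
  case: ifP => // _; apply: eq_big_nat => i /andP[i_gt0 ltim].
  have ltBi : (m.+1 - i < m.+1)%N by rewrite ltn_subrL i_gt0.
  by congr mulvs; apply: IHm => //; rewrite -ltnS; apply: leq_trans lemp || apply: leq_trans lemq.
by move=> lekn; apply: gen.
Qed.

Lemma powvsE k : (2 <= k)%N ->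
  powvs k = (\sum_(1 <= i < k) mulvs (powvs i) (powvs (k - i)))%VS.
Proof.
case: k => [|k] // k_gt1; rewrite {1}/powvs /= leqNgt k_gt1 /=.
apply: eq_big_nat => i /andP[i_gt0 ltik].
by rewrite !powvs_recE // -ltnS // ltn_subrL i_gt0.
Qed.

End NonassociativeAlgebra.

(* Main.v *)
Require Import Defs.
From mathcomp Require Import all_boot all_order all_algebra.
From mathcomp Require Import reals complex.

(** Write the defining identity as (xy)z = x(zy) - x(yz).  Its right-hand side
    changes sign when y and z are exchanged, so the right multiplications
    R_y : x |-> xy satisfy R_z R_y = R_(zy - yz) = - R_y R_z.  They thus form a
    space of anticommuting operators that is closed under composition.  In a
    triple product R_a R_b R_c, moving R_c to the front costs one sign when
    R_a R_b is regarded as a single right multiplication, and two signs when it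
    passes R_b and R_a in turn.  Hence 2 R_a R_b R_c = 0, that is
    ((xc)b)a = 0 away from characteristic 2 ([mul_left_normed4]).

    Consequently (uZ)Z = 0 for u in Z^2, and the defining identity shows that
    left multiplication by such a u does not distinguish ab from ba
    ([mul_pow2_comm]).  Combining this with the anticommutation of right
    multiplications gives Z^2 Z^5 = 0 ([mul_pow2_pow5]), and then Z^6 Z = 0
    ([mul_pow6]) because (at)w = - (aw)t.  So a long product survives only in
    the form at with a of degree one; but Z(Z Z^6) = 0 ([mul_mul_pow6]), since
    x(yt) = x(ty) - (xy)t.  Therefore Z^11 = 0 ([powvs_eq0]): the class of
    nilpotency is bounded independently of the dimension. *)

Set Implicit Arguments.
Unset Strict Implicit.
Unset Printing Implicit Defensive.

Local Open Scope ring_scope.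

Import GRing.Theory Num.Theory.

(** * Powers of a nonassociative algebra *)

Section Powers.
Variables (K : fieldType) (Z : vectType K) (mul : {bilinear Z -> Z -> Z}).
Local Notation "x ** y" := (mul x y) (at level 40, left associativity).

Lemma mem_powvs1 x : x \in powvs mul 1.
Proof. by rewrite powvs1 memvf. Qed.

Lemma mulvs_sub_powvs i k : (0 < i < k)%N ->
  (mulvs mul (powvs mul i) (powvs mul (k - i)) <= powvs mul k)%VS.
Proof.
case/andP=> i_gt0 ltik; rewrite [X in (_ <= X)%VS]powvsE; last first.
  exact: leq_ltn_trans i_gt0 ltik.
rewrite big_geq_mkord.
exact: (@sumv_sup _ _ _ (Ordinal ltik) (fun j : 'I_k => true && (1 <= j)%N)
  _ (fun j : 'I_k => mulvs mul (powvs mul j) (powvs mul (k - j)))).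
Qed.

Lemma powvs_subP k (W : {vspace Z}) : (2 <= k)%N ->
  (forall i u v, (0 < i < k)%N -> u \in powvs mul i ->
     v \in powvs mul (k - i) -> u ** v \in W) ->
  (powvs mul k <= W)%VS.
Proof.
move=> k_ge2 sW; rewrite powvsE // big_geq_mkord; apply/subv_sumP => i /= i_gt0.
by apply/mulvsP => u v; apply: sW; rewrite i_gt0 /=.
Qed.

Lemma mem_mul_powvs i k u v : (0 < i < k)%N ->
  u \in powvs mul i -> v \in powvs mul (k - i) -> u ** v \in powvs mul k.
Proof. by move=> /mulvs_sub_powvs/mulvsP; apply. Qed.

Lemma mem_mul_powvs2 u v : u ** v \in powvs mul 2.
Proof. by apply: (mem_mul_powvs (i := 1%N)); rewrite ?mem_powvs1. Qed.

(** Z^k is defined as a sum over all bracketings and not as a descending chain,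
    so that monotonicity requires lowering the degree of one factor. *)
Lemma powvsS_sub k : (0 < k)%N -> (powvs mul k.+1 <= powvs mul k)%VS.
Proof.
elim/ltn_ind: k => -[|[|k]] // IHk _; first by rewrite powvs1 subvf.
apply: powvs_subP => // -[|[|i]] // u v /andP[_ lt_i_k] Zu Zv.
  (* A left factor of degree one cannot be lowered. *)
  apply: (mem_mul_powvs (i := 1%N)); rewrite ?mem_powvs1 //.
  by move: Zv; rewrite !subn1 /=; apply/subvP/IHk.
apply: (mem_mul_powvs (i := i.+1)); rewrite ?ltnS //.
by apply: subvP Zu; apply: IHk.
Qed.

Lemma powvs_sub i k : (0 < i <= k)%N -> (powvs mul k <= powvs mul i)%VS.
Proof.
case/andP=> i_gt0 leik; rewrite -(subnKC leik); elim: (k - i)%N => [|d IHd].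
  by rewrite addn0.
by rewrite addnS (subv_trans _ IHd) // powvsS_sub // addn_gt0 i_gt0.
Qed.

Lemma mem_powvs_le i k w : (0 < i <= k)%N ->
  w \in powvs mul k -> w \in powvs mul i.
Proof. by move=> /powvs_sub/subvP; apply. Qed.

(** The vanishing of a composite of left and right multiplications is linear in
    its argument, which reduces it to a single product of two factors of
    complementary degrees. *)
Lemma powvs_linear_eq0 k (f : {linear Z -> Z}) : (2 <= k)%N ->
  (forall i u v, (0 < i < k)%N -> u \in powvs mul i ->
     v \in powvs mul (k - i) -> f (u ** v) = 0) ->
  forall w, w \in powvs mul k -> f w = 0.
Proof.
move=> k_ge2 f0 w Zw; apply/eqP; rewrite -lfunE -memv_ker.
apply: subvP w Zw; apply: powvs_subP => // i u v lt_i Zu Zv.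
by rewrite memv_ker lfunE; apply/eqP; apply: (f0 i).
Qed.

End Powers.

(** * Identities of anti-Zinbiel algebras *)

Section AntiZinbiel.
Variables (K : fieldType) (Z : vectType K) (mul : {bilinear Z -> Z -> Z}).
Hypotheses (two_neq0 : 2 != 0 :> K) (mulAZ : anti_zinbiel mul).
Local Notation "x ** y" := (mul x y) (at level 40, left associativity).

Lemma mul_assocE x y z : x ** y ** z = x ** (z ** y) - x ** (y ** z).
Proof. by rewrite (mulAZ x y z) opprD opprK addrCA subrr addr0. Qed.

Lemma mul_rightN x y z : x ** y ** z = - (x ** z ** y).
Proof. by rewrite !mul_assocE opprB. Qed.

(** Composing two right multiplications gives a right multiplication, so the
    last factor c can be exchanged either with a and b one at a time, or with
    the single element that acts as the composite of a and b; the two signs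
    disagree. *)
Lemma mul_left_normed4 x a b c : x ** a ** b ** c = 0.
Proof.
have composite : x ** a ** b ** c = - (x ** c ** a ** b).
  rewrite (mul_assocE x) (mul_assocE (x ** c)) linearBl.
  by rewrite (mul_rightN x (b ** a)) (mul_rightN x (a ** b)) opprB opprK addrC.
have stepwise : x ** a ** b ** c = x ** c ** a ** b.
  by rewrite mul_rightN (mul_rightN x a c) linearNl opprK.
apply/eqP; move/eqP: composite; rewrite -stepwise -addr_eq0 -mulr2n -scaler_nat.
by rewrite scaler_eq0 (negPf two_neq0).
Qed.

Lemma mul_pow2_left_normed u a b : u \in powvs mul 2 -> u ** a ** b = 0.
Proof.
apply: (powvs_linear_eq0 (f := applyr mul b \o applyr mul a)) => // i x y _ _ _.
exact: mul_left_normed4.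
Qed.

(** The difference of the two sides is (ub)a. *)
Lemma mul_pow2_comm u a b : u \in powvs mul 2 -> u ** (a ** b) = u ** (b ** a).
Proof.
move=> u2; apply/eqP; rewrite -subr_eq0 -mul_assocE.
by rewrite mul_pow2_left_normed.
Qed.

(** Both sides are compared through u((bw)a), where the right multiplications by
    w and a anticommute. *)
Lemma mul_pow2_regroup u a b w : u \in powvs mul 2 ->
  u ** (a ** (b ** w)) = - (u ** (b ** a ** w)).
Proof. by move=> u2; rewrite mul_pow2_comm // mul_rightN linearNr. Qed.

Lemma mul_pow2_mid u q a w : u \in powvs mul 2 -> q \in powvs mul 2 ->
  u ** (a ** (q ** w)) = 0.
Proof.
by move=> u2 q2; rewrite mul_pow2_comm // mul_pow2_left_normed // linear0r.
Qed.

(** For p = vy, regrouping turns u((wq)(vy)) into - u((v(wq))y).  There wq may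
    be replaced by qw, as v(wq) and v(qw) differ by (vw)q, which right
    multiplication by y kills.  Regrouping back leaves (qw)(vy), which is zero
    because q lies in Z^2. *)
Lemma mul_pow2_right2 u w q p : u \in powvs mul 2 ->
  q \in powvs mul 2 -> p \in powvs mul 2 -> u ** (w ** q ** p) = 0.
Proof.
move=> u2 q2; apply: (powvs_linear_eq0 (f := mul u \o mul (w ** q))) => //.
move=> i v y _ _ _ /=.
rewrite mul_pow2_regroup // (mulAZ v w q) linearDl linearNl.
rewrite mul_left_normed4 oppr0 add0r.
by rewrite -mul_pow2_regroup // mul_pow2_left_normed // linear0r.
Qed.

Lemma mul_pow2_pow2_pow3 u p t : u \in powvs mul 2 ->
  p \in powvs mul 2 -> t \in powvs mul 3 -> u ** (p ** t) = 0.
Proof.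
move=> u2 p2; apply: (powvs_linear_eq0 (f := mul u \o mul p)) => //= i a b lt_i.
have right2 x q : q \in powvs mul 2 -> u ** (p ** (x ** q)) = 0.
  by move=> q2; rewrite mul_pow2_regroup // mul_pow2_right2 // oppr0.
case: i lt_i => [|[|[|i]]] //= _ Za Zb; first exact: right2.
by rewrite (mul_pow2_comm _ _ p2) right2.
Qed.

Lemma mul_pow2_pow1_pow4 u a t : u \in powvs mul 2 -> t \in powvs mul 4 ->
  u ** (a ** t) = 0.
Proof.
move=> u2; apply: (powvs_linear_eq0 (f := mul u \o mul a)) => //= i b s lt_i.
case: i lt_i => [|[|i]] //= lt_i Zb Zs; last first.
  by rewrite mul_pow2_mid // (@mem_powvs_le _ _ _ 2 i.+2).
by rewrite mul_pow2_regroup // mul_pow2_pow2_pow3 ?oppr0 // mem_mul_powvs2.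
Qed.

(** Left multiplication by u in Z^2 is insensitive to the order of the factors
    of a product, so products of degree 1 + 4 and 2 + 3 cover all cases. *)
Lemma mul_pow2_pow5 u t : u \in powvs mul 2 -> t \in powvs mul 5 -> u ** t = 0.
Proof.
move=> u2; apply: (powvs_linear_eq0 (f := mul u)) => // i a b lt_i.
case: i lt_i => [|[|[|[|[|i]]]]] //= _ Za Zb.
- exact: mul_pow2_pow1_pow4.
- exact: mul_pow2_pow2_pow3.
- by rewrite mul_pow2_comm // mul_pow2_pow2_pow3.
- by rewrite mul_pow2_comm // mul_pow2_pow1_pow4.
Qed.

(** A factor of degree one on the left is handled by (at)w = - (aw)t, where aw
    has degree 2 and t degree 5; otherwise the left factor lies in Z^2. *)
Lemma mul_pow6 t w : t \in powvs mul 6 -> t ** w = 0.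
Proof.
apply: (powvs_linear_eq0 (f := applyr mul w)) => // -[|[|i]] a b // lt_i Za Zb /=.
  by rewrite mul_rightN mul_pow2_pow5 ?oppr0 // mem_mul_powvs2.
by rewrite mul_pow2_left_normed // (@mem_powvs_le _ _ _ 2 i.+2).
Qed.

Lemma mul_mul_pow6 x y t : t \in powvs mul 6 -> x ** (y ** t) = 0.
Proof.
move=> t6; rewrite mulAZ (mul_pow6 _ t6) linear0r addr0.
have t5 : t \in powvs mul 5 by apply: mem_powvs_le t6.
by rewrite (mul_pow2_pow5 (mem_mul_powvs2 _ x y) t5) oppr0.
Qed.

(** Either i >= 6 and Z^6 Z = 0 applies, or i <= 5 and the bound on k leaves
    degree at least 5 for the right factor, so that Z^2 Z^5 = 0 applies. *)
Lemma mul_pow_long i k u v : (10 <= k)%N -> (2 <= i < k)%N ->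
  u \in powvs mul i -> v \in powvs mul (k - i) -> u ** v = 0.
Proof.
move=> le10k /andP[i_ge2 ltik] Zu Zv; have [i_ge6|i_lt6] := leqP 6 i.
  by rewrite mul_pow6 // (@mem_powvs_le _ _ _ 6 i).
rewrite mul_pow2_pow5 ?(@mem_powvs_le _ _ _ 2 i) //.
apply: mem_powvs_le Zv; rewrite /= leq_subRL ?(ltnW ltik) //.
by apply: leq_trans le10k; rewrite (leq_add (i_lt6 : (i <= 5)%N) (leqnn 5)).
Qed.

Lemma mul_pow10 x k t : (10 <= k)%N -> t \in powvs mul k -> x ** t = 0.
Proof.
move=> le10k; apply: (powvs_linear_eq0 (f := mul x)) => [|i y s lt_i Zy Zs /=].
  exact: leq_trans le10k.
have /andP[i_gt0 lt_ik] := lt_i; case: (ltngtP i 1) => [|i_gt1|i1].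
- by rewrite ltnNge i_gt0.
- by rewrite (mul_pow_long le10k _ Zy Zs) ?i_gt1 // linear0r.
rewrite mul_mul_pow6 //; apply: mem_powvs_le Zs.
by rewrite i1 ltn_subRL (leq_trans _ le10k).
Qed.

Lemma powvs_eq0 k : (11 <= k)%N -> powvs mul k = 0%VS.
Proof.
move=> le11k; apply/eqP; rewrite -subv0.
apply: powvs_subP => [|i x t lt_i Zx Zt]; first exact: leq_trans le11k.
have /andP[i_gt0 lt_ik] := lt_i; rewrite memv0; apply/eqP.
case: (ltngtP i 1) => [|i_gt1|i1].
- by rewrite ltnNge i_gt0.
- by rewrite (mul_pow_long (ltnW le11k) _ Zx Zt) ?i_gt1.
apply: mul_pow10 Zt.
by rewrite i1 ltn_subRL (leq_trans _ le11k).
Qed.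

End AntiZinbiel.

Theorem theorem47 (R : realType) (Z : vectType R[i])
    (mul : {bilinear Z -> Z -> Z}) (hmul : anti_zinbiel mul) :
  nilpotent_alg mul.
Proof.
have two_neq0 : 2 != 0 :> R[i] by rewrite pnatr_eq0.
by exists 11%N => //; apply: (powvs_eq0 two_neq0 hmul).
Qed.
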